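(* For all integers $i\ge0$, $j\ge0$, $r\ge0$, $$\left[{i \atop j}\right]_r=(-1)^{i-j}\,c_{i-r,j-r,r};$$ in particular $\left[{i \atop j}\right]_r=0$ for $i<r$ and $\left[{r \atop j}\right]_r=\delta_{j,r}$.
   Context: The signed Stirling numbers of the first kind $s_{i,r}$ are defined by $x(x-1)\cdots(x-i+1)=\sum_{r=0}^{i}s_{i,r}x^r$. For integers $i,j\ge0$ and real $k$, $c_{i,j,k}=\sum_{r=j}^{i}\binom{r}{j}(-k)^{r-j}s_{i,r}$ (zero if $j>i$), and $c_{i,j,k}=0$ whenever $i<0$ or $j<0$. The $r$-Stirling numbers of the first kind (Broder) $\left[{n \atop m}\right]_r$ (for integers $n,r\ge 0$ and integer $m$) are defined by: $\left[{n \atop m}\right]_r=0$ for $n<r$; $\left[{r \atop m}\right]_r=\delta_{m,r}$; and $\left[{n \atop m}\right]_r=(n-1)\left[{n-1 \atop m}\right]_r+\left[{n-1 \atop m-1}\right]_r$ for $n>r$. (Combinatorially, for $m\ge 0$ this is the number of permutations of $\{1,\dots,n\}$ with $m$ cycles in which $1,\dots,r$ lie in distinct cycles.) $\delta$ is the Kronecker delta. *)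

(* Defs.v *)
From HB Require Import structures.
From mathcomp Require Import all_boot all_order all_algebra.
From mathcomp Require Import reals.

Set Implicit Arguments.
Unset Strict Implicit.
Unset Printing Implicit Defensive.

Import GRing.Theory Num.Theory.
Local Open Scope ring_scope.

(* Signed Stirling numbers of the first kind: coefficient of x^r in
   x (x - 1) ... (x - i + 1). *)
Definition stirling1 (i r : nat) : int :=
  (\prod_(0 <= l < i) ('X - (l%:Z)%:P) : {poly int})`_r.

(* c_{i,j,k} for arbitrary integers i, j; the range of summation is empty
   when i < j, and the negative indices fall into the last branch. *)
Definition c (R : realType) (i j : int) (k : R) : R :=
  match i, j with
  | Posz i, Posz j =>
      \sum_(j <= r < i.+1)
        'C(r, j)%:R * (- k) ^+ (r - j)%N * (stirling1 i r)%:~R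
  | _, _ => 0
  end.

(* Broder's r-Stirling numbers of the first kind, [n over m]_r; the lower index
   m is an integer because the recurrence refers to m - 1. *)
Fixpoint rstirling1 (r n : nat) (m : int) {struct n} : nat :=
  if (n < r)%N then 0%N
  else if (n == r)%N then nat_of_bool (m == r%:Z)
  else if n is n'.+1 then
    (n' * rstirling1 r n' m + rstirling1 r n' (m - 1))%N
  else 0%N.

(* Main.v *)
(** The number [c n m k] is the coefficient of [x^m] in the shifted falling
    factorial [(x - k) (x - k - 1) ... (x - k - n + 1)]: expand each power of
    [x - k] by the binomial theorem.  Splitting off the last factor gives
    [c (n+1) m k = c n (m-1) k - (k + n) c n m k], which at [k = r] is Broder's
    recurrence for [[r+n over r+m]_r] up to the alternating sign. *)
Require Import Defs.
From HB Require Import structures.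
From mathcomp Require Import all_boot all_order all_algebra.
From mathcomp Require Import reals.

Set Implicit Arguments.
Unset Strict Implicit.
Unset Printing Implicit Defensive.

Import GRing.Theory Num.Theory.
Local Open Scope ring_scope.

Lemma coef_XsubC_exp (R : comNzRingType) (k : R) (n m : nat) :
  (('X - k%:P) ^+ n)`_m = 'C(n, m)%:R * (- k) ^+ (n - m).
Proof.
rewrite addrC -polyCN exprDn coef_sum.
under eq_bigr => i _ do
  rewrite coefMn -polyC_exp coefCM coefXn mulr_natr -mulrnA mulnC.
(* When [n < m] the binomial coefficient vanishes, so the truncated exponent [n - m] does no
   harm. *)
have [le_mn | lt_nm] := leqP m n; last first.
  rewrite bin_small // mul0r big1 // => i _.
  by rewrite gtn_eqF ?muln0 ?mulr0n // (leq_ltn_trans _ lt_nm) // -ltnS.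
rewrite (bigD1 (Ordinal (le_mn : (m < n.+1)%N))) //= eqxx muln1 mulr_natl.
rewrite big1 ?addr0 // => i neq_im.
have /negPf -> : m != i by apply: contraNneq neq_im => eq_mi; apply/eqP/val_inj.
by rewrite muln0 mulr0n.
Qed.

Lemma c_coef (R : realType) (n m : nat) (k : R) :
  c n m k = (\prod_(0 <= l < n) ('X - (k + l%:R)%:P))`_m.
Proof.
pose F : {poly int} := \prod_(0 <= l < n) ('X - (l%:Z)%:P).
have szF : size F = n.+1.
  by rewrite /F size_prod_XsubC size_iota subn0.
(* Shifting by [k] is composition with ['X - k%:P], so the Stirling numbers enter as the
   coefficients of the integer polynomial [F]. *)
have -> : \prod_(0 <= l < n) ('X - (k + l%:R)%:P)
        = map_poly intr F \Po ('X - k%:P).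
  rewrite rmorph_prod rmorph_prod /=; apply: eq_bigr => l _.
  by rewrite map_polyXsubC comp_polyB comp_polyX comp_polyC polyCD opprD addrA.
rewrite comp_polyE coef_sum size_map_inj_poly ?szF //; last exact: intr_inj.
(* The sum defining [c] may start at [0] instead of [m]: the added terms have [r < m] and hence a
   zero binomial. *)
rewrite [LHS](_ : _ = \sum_(0 <= r < n.+1)
    'C(r, m)%:R * (- k) ^+ (r - m)%N * (stirling1 n r)%:~R).
  rewrite big_mkord; apply: eq_bigr => r _.
  by rewrite coefZ coef_map /= coef_XsubC_exp mulrC.
have bin0 r : (r < m)%N ->
    'C(r, m)%:R * (- k) ^+ (r - m)%N * (stirling1 n r)%:~R = 0 :> R.
  by move=> lt_rm; rewrite bin_small // !mul0r.
have [le_mn | lt_nm] := leqP m n.+1.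
  rewrite [RHS](big_cat_nat (n := m)) //= [X in _ = X + _]big_nat_cond.
  by rewrite [X in _ = X + _]big1 ?add0r // => r /andP[/andP[_ /bin0]].
rewrite /c big_geq ?(ltnW lt_nm) // big_nat_cond big1 // => r.
by move=> /andP[/andP[_ lt_rn] _]; apply/bin0/(ltn_trans lt_rn).
Qed.

Lemma c0 (R : realType) (m : int) (k : R) : c 0 m k = (m == 0)%:R.
Proof. by case: m => m //; rewrite c_coef big_geq // coef1. Qed.

Lemma cS (R : realType) (n : nat) (m : int) (k : R) :
  c n.+1 m k = c n (m - 1) k - (k + n%:R) * c n m k.
Proof.
case: m => [[|m]|m].
(* Multiplication by ['X] leaves no constant term, in agreement with the value [0] of [c] at lower
   index [-1]. *)
- by rewrite !c_coef big_nat_recr //= mulrBr coefB coefMX coefMC mulrC.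
- have -> : m.+1%:Z - 1 = m by rewrite -addn1 PoszD addrK.
  by rewrite !c_coef big_nat_recr //= mulrBr coefB coefMX coefMC mulrC.
- have -> : Negz m - 1 = Negz m.+1 by rewrite !NegzE -opprD -PoszD addn1.
  by rewrite /= mulr0 subr0.
Qed.

Lemma rstirling1_lt (r n : nat) (m : int) : (n < r)%N -> rstirling1 r n m = 0%N.
Proof. by case: n => [|n] /= ->. Qed.

Lemma rstirling1_diag (r : nat) (m : int) : rstirling1 r r m = (m == r%:Z).
Proof. by case: r => [|r] //=; rewrite ltnn eqxx. Qed.

Lemma rstirling1S (r n : nat) (m : int) : (r <= n)%N ->
  rstirling1 r n.+1 m = (n * rstirling1 r n m + rstirling1 r n (m - 1))%N.
Proof. by move=> le_rn /=; rewrite ltnNge leqW //= gtn_eqF. Qed.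

(** Writing the upper index as [r + n] lets the induction start on the diagonal; [m] ranges over all
    integers so that the hypothesis also applies at [m - 1]. *)
Lemma rstirling1_c (R : realType) (r n : nat) (m : int) :
  (rstirling1 r (r + n) m)%:R
    = (-1) ^ (n%:Z - (m - r%:Z)) * c n (m - r%:Z) (r%:R : R).
Proof.
elim: n m => [|n IHn] m.
  rewrite addn0 rstirling1_diag c0 subr_eq0.
  by case: eqVneq => [->|_]; rewrite ?mulr0 // subrr mulr1.
rewrite addnS rstirling1S ?leq_addr // natrD natrM !IHn cS addrAC.
set s := m - r%:Z.
(* The signs at [(n, s - 1)] and [(n.+1, s)] agree and are opposite to the one at [(n, s)], which
   turns the factor [- (r + n)] of [cS] into Broder's [r + n]. *)
have -> : n%:Z - (s - 1) = 1 + (n%:Z - s) by rewrite opprB addrCA.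
have -> : n.+1%:Z - s = 1 + (n%:Z - s) by rewrite -add1n PoszD addrA.
rewrite (expfzDr 1 (n%:Z - s)) ?oppr_eq0 ?oner_eq0 // expr1z !mulN1r natrD.
by rewrite mulrBr !mulNr opprK mulrCA [RHS]addrC.
Qed.

Theorem theorem2p9 (R : realType) (i j r : nat) :
  [/\ (rstirling1 r i j%:Z)%:R
        = (-1) ^ (i%:Z - j%:Z) * c (i%:Z - r%:Z) (j%:Z - r%:Z) (r%:R : R),
      (i < r)%N -> rstirling1 r i j%:Z = 0%N
    & rstirling1 r r j%:Z = nat_of_bool (j == r)].
Proof.
split; [|exact: rstirling1_lt|exact: rstirling1_diag].
have [le_ri | lt_ir] := leqP r i.
  rewrite -(subnKC le_ri) rstirling1_c PoszD [r%:Z + _]addrC addrK.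
  by rewrite opprB addrA.
rewrite rstirling1_lt //.
(* [Negz p] stands for [- (p + 1)], hence [i.+1]; at a negative upper index [c] is [0] by
   definition. *)
have -> : i%:Z - r%:Z = Negz (r - i.+1).
  by rewrite NegzE -subSn // subSS -subzn ?opprB // ltnW.
by rewrite mulr0.
Qed.
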